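(* Let $\pi$ be a set of primes and let $G$ be a finite $\pi'$-soluble group. Then $\operatorname{Proj}_{\mathfrak N^\pi}(G)\neq\emptyset$, $\operatorname{Proj}_{\mathfrak N^\pi}(G)=\operatorname{Cov}_{\mathfrak N^\pi}(G)$, and this set is a conjugacy class of subgroups of $G$.
   Context: All groups are finite. $\pi$ is an arbitrary (possibly empty) set of primes and $\pi'$ is its complement in the set of all primes. A $\pi$-group is a finite group all of whose order's prime divisors lie in $\pi$. A group $G$ is $\pi'$-soluble if every composition factor of $G$ is either a $\pi$-group or a $p$-group for some prime $p\in\pi'$. $\mathfrak N^\pi$ is the class of all finite groups isomorphic to $H\times K$ with $H$ a $\pi$-group and $K$ a nilpotent $\pi'$-group. For a class $\mathfrak X$ of groups, a subgroup $U$ of $G$ is $\mathfrak X$-maximal in $G$ if $U\in\mathfrak X$ and no subgroup of $G$ belonging to $\mathfrak X$ properly contains $U$. A subgroup $U$ of $G$ is an $\mathfrak X$-projector of $G$ if $UK/K$ is $\mathfrak X$-maximal in $G/K$ for every normal subgroup $K$ of $G$; $\operatorname{Proj}_{\mathfrak X}(G)$ is the set of $\mathfrak X$-projectors of $G$. A subgroup $E$ of $G$ is an $\mathfrak X$-covering subgroup of $G$ if $E\in\operatorname{Proj}_{\mathfrak X}(L)$ whenever $E\le L\le G$; $\operatorname{Cov}_{\mathfrak X}(G)$ is the set of $\mathfrak X$-covering subgroups of $G$. *)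

(* Defs.v *)
From mathcomp Require Import all_boot all_fingroup all_solvable.

Set Implicit Arguments.
Unset Strict Implicit.
Unset Printing Implicit Defensive.

Local Open Scope group_scope.

(* A class of finite groups must apply to groups over varying carrier types,
   since the quotients of G do not live in the same type as G. *)
Definition group_class := forall gT : finGroupType, {group gT} -> Prop.

(* A set of primes is a nat_pred; pi.-group and pi^'.-group only test
   membership of the prime divisors of the order, so non-primes in pi are
   immaterial. *)
Definition Npi (pi : nat_pred) : group_class := fun gT X =>
  exists (aT rT : finGroupType) (H : {group aT}) (K : {group rT}),
    [/\ pi.-group H, pi^'.-group K, nilpotent K & X \isog setX H K].

Definition composition_factor (gT : finGroupType) (G : {group gT})
    (F : section gT) : Prop :=
  exists2 s : seq {group gT}, comps G s & F \in pairmap (@mkSec gT) G s.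

Definition pi'_soluble (pi : nat_pred) (gT : finGroupType)
    (G : {group gT}) : Prop :=
  forall F : section gT, composition_factor G F ->
    pi.-group F \/ exists p : nat, [/\ prime p, p \in pi^' & p.-group F].

Definition Xmaximal (X : group_class) (gT : finGroupType)
    (G U : {group gT}) : Prop :=
  [/\ U \subset G, X gT U &
    forall V : {group gT}, V \subset G -> X gT V -> ~~ (U \proper V)].

(* U / K is the image of U in G / K, that is, UK/K. *)
Definition projector (X : group_class) (gT : finGroupType)
    (G U : {group gT}) : Prop :=
  U \subset G /\
  forall K : {group gT}, K <| G -> Xmaximal X (G / K)%G (U / K)%G.

Definition covering (X : group_class) (gT : finGroupType)
    (G E : {group gT}) : Prop :=
  E \subset G /\
  forall L : {group gT}, E \subset L -> L \subset G -> projector X L E.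

Definition conjugacy_class_of_subgroups (gT : finGroupType) (G : {group gT})
    (P : {group gT} -> Prop) : Prop :=
  exists2 U : {group gT}, U \subset G &
    forall V : {group gT}, P V <-> exists2 x, x \in G & V :=: U :^ x.

(* Main.v *)
(* Let N be a normal subgroup of T that is a tau-group, where tau is pi or a
   single prime of pi', with T / N in N^pi. Then T / N is the direct product of
   a tau-group and a tau'-group, so by Schur-Zassenhaus T has a Hall
   tau'-subgroup S, with N S normal in T, and any two such subgroups are
   conjugate. A Frattini argument shows that U = 'N_T(S) = 'C_M(S) \x S
   (M = 'O_tau(T)) supplements N; it lies in N^pi, it contains a conjugate of
   every N^pi-subgroup supplementing N, and it covers every N^pi-quotient of
   every intermediate group. Applying this with N = 'O_tau(G) <> 1 and T / N a
   covering subgroup (or a projector) of G / N gives both the existence of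
   covering subgroups and the conjugacy of projectors by induction on #|G|; all
   projectors are then conjugate to a covering subgroup. *)

Require Import Defs.
From mathcomp Require Import all_boot all_fingroup all_solvable.

Set Implicit Arguments.
Unset Strict Implicit.
Unset Printing Implicit Defensive.

Local Open Scope group_scope.

(** * The class [Npi pi]: internal form, closure properties, splittings *)

Section NpiClass.

Variable pi : nat_pred.

Lemma NpiP (gT : finGroupType) (X : {group gT}) :
  Npi pi X <-> exists A B : {group gT},
    [/\ A \x B = X, pi.-group A, pi^'.-group B & nilpotent B].
Proof.
split=> [[aT [rT [H [K [piH piK nilK isoX]]]]] | [A [B [defX piA piB nilB]]]].
  rewrite isog_sym in isoX; case/isogP: isoX => f injf defX.
  have sH : setX H 1 \subset setX H K by rewrite setXS ?sub1G.
  have sK : setX 1 K \subset setX H K by rewrite setXS ?sub1G.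
  exists (f @* setX H 1)%G, (f @* setX 1 K)%G; split => /=.
  - by rewrite (injm_dprod (subxx _) injf (setX_dprod H K)).
  - by rewrite morphim_pgroup //= -(isog_pgroup _ (isog_setX1 _ H)).
  - by rewrite morphim_pgroup //= -(isog_pgroup _ (isog_set1X _ K)).
  - by rewrite morphim_nil //= -(isog_nil (isog_set1X _ K)).
exists gT, gT, A, B; split=> //.
exact: isog_dprod defX (setX_dprod A B) (isog_setX1 _ A) (isog_set1X _ B).
Qed.

(** The two factors have coprime orders, so their images again form a direct product. *)
Lemma Npi_homg (gT rT : finGroupType) (X : {group gT}) (Y : {group rT}) :
  Y \homg X -> Npi pi X -> Npi pi Y.
Proof.
case/homgP=> f defY /NpiP[A [B [defX piA piB nilB]]]; apply/NpiP.
exists (f @* A)%G, (f @* B)%G; split; rewrite ?morphim_pgroup ?morphim_nil //=.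
rewrite -defY (morphim_coprime_dprod _ (subxx _) defX) //.
exact: pnat_coprime piA piB.
Qed.

Lemma Npi_isog (gT rT : finGroupType) (X : {group gT}) (Y : {group rT}) :
  X \isog Y -> Npi pi X -> Npi pi Y.
Proof. by rewrite isog_sym => /isog_hom; apply: Npi_homg. Qed.

Lemma Npi_dprod (gT : finGroupType) (X Y Z : {group gT}) :
  X \x Y = Z -> Npi pi X -> Npi pi Y -> Npi pi Z.
Proof.
move=> defZ /NpiP[A [B [defX piA piB nilB]]] /NpiP[C [D [defY piC piD nilD]]].
have defZ' : (A \x C) \x (B \x D) = Z.
  by rewrite dprodA -(dprodA A) (dprodC C) !dprodA defX -dprodA defY.
case/dprodP: (defZ') => [[AC BD defAC defBD] _ _ _].
rewrite defAC defBD in defZ'; apply/NpiP; exists AC, BD; split=> //.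
- by case/dprodP: defAC => _ <- _ _; rewrite pgroupM piA.
- by case/dprodP: defBD => _ <- _ _; rewrite pgroupM piB.
- by rewrite (dprod_nil defBD) nilB.
Qed.

(* The two kinds of chief factors of a pi'-soluble group. *)
Definition admissible (tau : nat_pred) : Prop :=
  tau = pi \/ exists p : nat, [/\ prime p, p \in pi^' & tau = p].

Lemma Npi_admissible (tau : nat_pred) (gT : finGroupType) (X : {group gT}) :
  admissible tau -> tau.-group X -> Npi pi X.
Proof.
case=> [-> piX | [p [p_pr pi'p ->]] pX]; apply/NpiP.
  by exists X, 1%G; rewrite dprodg1 pgroup1 nilpotent1.
exists 1%G, X; rewrite dprod1g pgroup1 (pgroup_nil pX); split=> //.
by apply: sub_pgroup pX => q /eqP->.
Qed.

(** When [tau] is a prime [p], the Sylow subgroup ['O_p(B)] is split off the nilpotent factor and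
    ['O_p^'(B)] joins [A]. The second factor may then fail to be nilpotent; for [tau = pi] its
    nilpotency is kept as a source of solubility. *)
Lemma Npi_split (tau : nat_pred) (gT : finGroupType) (X : {group gT}) :
    admissible tau -> Npi pi X ->
  exists A B : {group gT},
    [/\ A \x B = X, tau.-group A, tau^'.-group B & tau = pi -> nilpotent B].
Proof.
case=> [-> | [p [p_pr pi'p ->]]] /NpiP[A [B [defX piA piB nilB]]].
  by exists A, B.
have defB := nilpotent_pcoreC p nilB.
have defX' : 'O_p(B) \x (A \x 'O_p^'(B)) = X.
  by rewrite dprodA (dprodC _ A) -dprodA defB.
case/dprodP: (defX') => [[_ C _ defC] _ _ _].
exists 'O_p(B)%G, C; split; rewrite ?pcore_pgroup //; first by rewrite -defC.
  case/dprodP: defC => _ <- _ _; rewrite pgroupM pcore_pgroup andbT.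
  by apply: sub_pgroup piA => q pi_q; apply: contraNneq pi'p => <-.
(* Here [tau = pi] is absurd, since [p] lies outside [pi]. *)
by move=> def_p; rewrite -def_p !inE eqxx in pi'p.
Qed.

Lemma homg_dprodr (gT : finGroupType) (X Y Z : {group gT}) :
  X \x Y = Z -> Y \homg Z.
Proof.
case/dprodP=> _ defZ cXY tiXY; have nXY := cents_norm cXY.
have nXZ : Z \subset 'N(X) by rewrite -defZ mul_subG ?normG.
apply: homg_trans (quotient_homg nXZ); apply: isog_hom.
by rewrite /= -defZ quotientMidl; apply: quotient_isog.
Qed.

End NpiClass.

(** * Hall [tau^']-subgroups, and extensions of [Npi pi] groups by [tau]-groups *)

Lemma Hall_dprodr (tau : nat_pred) (gT : finGroupType) (A B X : {group gT}) :
  A \x B = X -> tau.-group A -> tau^'.-group B -> tau^'.-Hall(X) B.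
Proof.
move=> defX tauA tau'B; have [_ nsB] := dprod_normal2 defX.
rewrite /pHall (normal_sub nsB) tau'B -divgS ?(normal_sub nsB) //=.
by rewrite -(dprod_card defX) mulnK // pnatNK.
Qed.

(** The [tau^']-factor of [X] is a normal Hall subgroup, hence equals ['O_tau^'(X)] and is the only
    Hall [tau^']-subgroup. *)
Lemma Npi_normal_Hall (pi tau : nat_pred) (gT : finGroupType)
    (X S : {group gT}) :
  admissible pi tau -> Npi pi X -> tau^'.-Hall(X) S -> S <| X.
Proof.
move=> adm XX hallS; have [A [B [defX tauA tau'B _]]] := Npi_split adm XX.
have [_ nsB] := dprod_normal2 defX.
have hallB := Hall_dprodr defX tauA tau'B.
have hallO : tau^'.-Hall(X) 'O_tau^'(X) by rewrite (normal_Hall_pcore hallB nsB).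
by rewrite (eq_Hall_pcore hallO hallS) pcore_normal.
Qed.

(** The fourth conclusion will give conjugacy of projectors; the fifth will give maximality of [U]
    modulo normal subgroups, for the existence of covering subgroups. *)
Lemma Npi_extension (pi tau : nat_pred) (gT : finGroupType)
    (T N : {group gT}) :
    admissible pi tau -> N <| T -> tau.-group N -> Npi pi (T / N)%G ->
  exists U : {group gT},
  [/\ U \subset T, Npi pi U, N * U = T,
      forall V : {group gT}, V \subset T -> Npi pi V -> N * V = T ->
        exists2 x, x \in T & V \subset U :^ x
    & forall W R : {group gT}, U \subset W -> W \subset T -> R <| W ->
        Npi pi (W / R)%G -> W \subset R * U].
Proof.
move=> adm nsNT tauN XTN; have [sNT nNT] := andP nsNT.
have [A [B [defTN tauA tau'B nilB]]] := Npi_split adm XTN.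
have XB := Npi_homg (homg_dprodr defTN) XTN.
have [nsA nsB] := dprod_normal2 defTN.
have hallB := Hall_dprodr defTN tauA tau'B.
(* [M] and [Q] are the full preimages of the [tau]- and [tau^']-factors of [T / N]; [S] will be a
   complement of [N] in [Q]. *)
have [M /group_inj defM sNM nsMT] := inv_quotientN nsNT nsA.
have [Q /group_inj defQ sNQ nsQT] := inv_quotientN nsNT nsB.
subst A B.
have nsNQ := normalS sNQ (normal_sub nsQT) nsNT.
have [sQT nQT] := andP nsQT; have [sMT nMT] := andP nsMT.
have tauM : tau.-group M.
  by rewrite -(pquotient_pgroup tauN) ?(subset_trans sMT).
have hallN : tau.-Hall(Q) N.
  by rewrite /pHall sNQ tauN -card_quotient ?(subset_trans sQT).
have /splitsP[S /complP[tiNS defQS]] :=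
  SchurZassenhaus_split (pHall_Hall hallN) nsNQ.
have sSQ : S \subset Q by rewrite -defQS mulG_subr.
have sST := subset_trans sSQ sQT; have nNS := subset_trans sST nNT.
have isoS : S \isog Q / N.
  by rewrite -defQS quotientMidl; apply: quotient_isog.
have tau'S : tau^'.-group S by rewrite (isog_pgroup _ isoS).
have XS : Npi pi S by apply: Npi_isog XB; rewrite isog_sym.
have defT : M * S = T.
  have -> : M * S = M * Q by rewrite -defQS mulgA (mulGSid sNM).
  apply/eqP; rewrite eqEsubset mul_subG //=.
  have [_ defAB _ _] := dprodP defTN.
  have : T / N \subset M / N * (Q / N) by rewrite defAB.
  rewrite -quotientMl ?(subset_trans sMT) // quotientSK //.
  by rewrite mulgA (mulSGid sNM).
have coMS : coprime #|M| #|S| := pnat_coprime tauM tau'S.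
have hallS : tau^'.-Hall(T) S.
  rewrite /pHall sST -divgS // -defT coprime_cardMg // mulnK // pnatNK.
  by apply/and3P.
have coNS : coprime #|N| #|S| := pnat_coprime tauN tau'S.
have inQ (K : {group gT}) : K \subset T -> tau^'.-group K -> K \subset Q.
  move=> sKT tau'K; rewrite -(mulSGid sNQ) -quotientSK ?(subset_trans sKT) //.
  by rewrite (sub_normal_Hall hallB nsB) ?quotientS ?quotient_pgroup //.
(* By Dedekind's law [S1] lies in [(N :&: Y) * S], so Schur-Zassenhaus provides a conjugating
   element inside [Y] itself, as the Frattini argument requires. *)
have trans (Y S1 : {group gT}) : S \subset Y -> Y \subset T ->
    S1 \subset Y -> S1 \subset Q -> #|S1| = #|S| ->
  exists2 x, x \in Y & S1 :=: S :^ x.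
  move=> sSY sYT sS1Y sS1Q oS1.
  have nNYS := normsI nNS (normsG sSY).
  have sS1NS : S1 \subset (N :&: Y) * S.
    by rewrite setIC group_modr // subsetI sS1Y defQS.
  have coNYS : coprime #|N :&: Y| #|S|.
    by rewrite (coprime_dvdl (cardSg (subsetIl _ _))).
  (* Solubility comes from [S], a copy of the nilpotent [Q / N], if [tau = pi], and from the
     [p]-group [N :&: Y] otherwise. *)
  case: adm => [tau_pi | [p [p_pr pi'p def_tau]]].
    have solS : solvable S by rewrite (isog_sol isoS) nilpotent_sol ?nilB.
    have [|x /setIP[_ Yx] ->] :=
      SchurZassenhaus_trans_actsol (G := (N :&: Y)%G) solS nNYS _ coNYS
        (esym oS1).
      by rewrite norm_joinEl ?(normC nNYS).
    by exists x.
  have solNY : solvable (N :&: Y).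
    apply: solvableS (subsetIl _ _) _; apply: (@pgroup_sol _ p).
    by rewrite def_tau in tauN.
  have [x /setIP[_ Yx] ->] :=
    SchurZassenhaus_trans_sol (H := (N :&: Y)%G) solNY nNYS sS1NS coNYS oS1.
  by exists x.
have frattini (R W : {group gT}) : R <| W -> S \subset R -> W \subset T ->
    W \subset R * 'N_T(S).
  move=> /andP[sRW nRW] sSR sWT; apply/subsetP=> w Ww.
  have sSwR : S :^ w \subset R by rewrite -(normsP nRW w Ww) conjSg.
  have sSwQ : S :^ w \subset Q.
    by rewrite -(normsP nQT w (subsetP sWT w Ww)) conjSg.
  have [x Rx defSw] := trans R (S :^ w)%G sSR (subset_trans sRW sWT) sSwR sSwQ
    (cardJg _ _).
  (* Since [S :^ w = S :^ x], the element [u] normalises [S]; moving [x] to the left of [u] keeps it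
     in [R]. *)
  rewrite /= in defSw; pose u := w * x^-1.
  have Wu : u \in W by rewrite groupM ?groupV // (subsetP sRW).
  have -> : w = x ^ u^-1 * u by rewrite -conjgCV /u mulgVK.
  rewrite mem_mulg ?memJ_norm ?groupV ?(subsetP nRW) // inE (subsetP sWT) //.
  by apply/normP; rewrite conjsgM defSw conjsgK.
exists 'N_T(S)%G; split=> /=.
- exact: subsetIl.
(* Dedekind's law in [T = M * S] gives the product; coprimeness turns ['N_M(S)] into a centraliser
   of [S]. *)
- have defU : 'N_M(S) \x S = 'N_T(S).
    rewrite dprodE.
    - by rewrite /= ![_ :&: 'N(S)]setIC group_modr ?normG // defT.
    - rewrite /= (coprime_norm_cent (subset_trans sST nMT)) // centsC.
      exact: subsetIr.
    - by rewrite /= setIAC (coprime_TIg coMS) setI1g.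
  apply: (Npi_dprod (X := 'N_M(S)%G) (Y := S) defU) => //.
  by apply: Npi_admissible adm _; apply: pgroupS tauM; apply: subsetIl.
- apply/eqP; rewrite eqEsubset mul_subG ?subsetIl //=.
  have := frattini Q T nsQT sSQ (subxx _).
  by rewrite -defQS -mulgA (mulSGid (_ : S \subset 'N_T(S))) // subsetI sST normG.
- move=> V sVT XV defNV.
  have [C [D [defV tauC tau'D _]]] := Npi_split adm XV.
  have [_ nsD] := dprod_normal2 defV.
  have sDT := subset_trans (normal_sub nsD) sVT.
  (* Compare [tau^']-parts in the product formula for [N * V = T]: [N] and [N :&: V] contribute
     1. *)
  have oD : #|D| = #|S|.
    rewrite (card_Hall hallS) (card_Hall (Hall_dprodr defV tauC tau'D)).
    have tau'1 (K : {group gT}) : tau.-group K -> partn #|K| tau^' = 1%N.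
      by move=> tauK; rewrite part_p'nat ?pnatNK.
    have := congr1 (partn^~ tau^') (mul_cardG N V).
    by rewrite /= defNV !partnM // tau'1 //
               (tau'1 _ (pgroupS (subsetIl N V) tauN)) mul1n muln1.
  have [x Tx defD] := trans T D sST (subxx _) sDT (inQ D sDT tau'D) oD.
  exists x => //; rewrite conjIg (conjGid Tx) -normJ -defD subsetI sVT.
  by case/andP: nsD.
move=> W R sUW sWT nsRW XWR.
have sSW : S \subset W by rewrite (subset_trans _ sUW) // subsetI sST normG.
(* The Hall subgroup [S / R] is normal in [W / R], so its preimage [K = R * S] is normal in [W].
   Frattini in [K] gives [W] inside [R * S * 'N_T(S)], which is [R * 'N_T(S)]. *)
have nSR : S / R <| W / R.
  apply: Npi_normal_Hall adm XWR _; rewrite quotient_pHall //.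
    exact: subset_trans sSW (normal_norm nsRW).
  exact: pHall_subl sSW sWT hallS.
have [K /group_inj /= defK sRK nsKW] :=
  inv_quotientN (Kbar := (S / R)%G) nsRW nSR.
have sKRS : K \subset R * S.
  rewrite -quotientSK; first by rewrite -[K / R]/(gval (K / R)%G) -defK.
  exact: subset_trans (normal_sub nsKW) (normal_norm nsRW).
have sSK : S \subset K.
  rewrite -(mulSGid sRK) -quotientSK; last first.
    exact: subset_trans sSW (normal_norm nsRW).
  by rewrite -[K / R]/(gval (K / R)%G) -defK.
apply: subset_trans (frattini K W nsKW sSK sWT) _.
apply: subset_trans (mulSg _ sKRS) _.
by rewrite -mulgA (mulSGid (_ : S \subset 'N_T(S))) // subsetI sST normG.
Qed.

(** * Subnormal series with admissible factors *)

(** Factors may be trivial or non-simple, so images of a series in a quotient form a series without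
    any refinement. *)
Inductive admissible_series (pi : nat_pred) (gT : finGroupType) :
    {group gT} -> Prop :=
  | AdmissibleTriv : admissible_series pi 1%G
  | AdmissibleStep (G H : {group gT}) tau :
      H <| G -> admissible pi tau -> tau.-nat #|G : H| ->
      admissible_series pi H -> admissible_series pi G.

Lemma pi'_soluble_series (pi : nat_pred) (gT : finGroupType) (G : {group gT}) :
  pi'_soluble pi G -> admissible_series pi G.
Proof.
move=> solG; have [s compG] := exists_comps G.
have {solG} : forall F, F \in pairmap (@mkSec gT) G s ->
    pi.-group F \/ exists p : nat, [/\ prime p, p \in pi^' & p.-group F].
  by move=> F sF; apply: solG; exists s.
elim: s G compG => [|H s IHs] G /compsP[/= lastG]; first by rewrite lastG; left.
case/andP=> /maxgroupp/andP[ltHG nHG] pathH solG.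
have nsHG : H <| G by apply/andP; split; first exact: proper_sub ltHG.
have serH : admissible_series pi H.
  by apply: IHs => [|F sF]; [apply/compsP | apply: solG; rewrite inE sF orbT].
have [] := solG (mkSec G H) (mem_head _ _).
  rewrite /pgroup /= card_quotient // => piGH.
  by apply: AdmissibleStep nsHG _ piGH serH; left.
case=> p [p_pr pi'p]; rewrite /pgroup /= card_quotient // => pGH.
by apply: AdmissibleStep nsHG _ pGH serH; right; exists p.
Qed.

Lemma admissible_series_quotient (pi : nat_pred) (gT : finGroupType)
    (G N : {group gT}) :
  G \subset 'N(N) -> admissible_series pi G -> admissible_series pi (G / N)%G.
Proof.
move=> + serG; elim: serG => [|{}G H tau nsHG adm tauGH _ IH] nNG.
  by rewrite [(_ / _)%G](group_inj (quotient1 N)); left.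
have sHG := normal_sub nsHG.
apply: AdmissibleStep (quotient_normal N nsHG) adm _ (IH (subset_trans sHG nNG)).
by apply: pnat_dvd tauGH; apply: index_quotient; apply: subIset; rewrite nNG.
Qed.

(** Climb the series: above the trivial group [G] is itself a [tau]-group, and later ['O_sigma(H)],
    characteristic in the normal subgroup [H], lies in ['O_sigma(G)]. *)
Lemma admissible_series_pcore (pi : nat_pred) (gT : finGroupType)
    (G : {group gT}) :
    admissible_series pi G -> G :!=: 1 ->
  exists2 tau, admissible pi tau & 'O_tau(G) != 1.
Proof.
elim=> [|{}G H tau nsHG adm tauGH _ IH] ntG; first by rewrite eqxx in ntG.
have [H1 | /IH[sigma adm_s ntO]] := eqVneq (H : {set gT}) 1.
  exists tau => //; rewrite pcore_pgroup_id //.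
  by rewrite /pgroup -indexg1 -H1.
exists sigma => //; apply: subG1_contra ntO.
apply: pcore_max (pcore_pgroup _ _) _.
exact: gFnormal_trans.
Qed.

(** * Projectors and covering subgroups under quotients and conjugation *)

Lemma Npi_morphim_quotient (pi : nat_pred) (aT rT : finGroupType)
    (D V K : {group aT}) (f : {morphism D >-> rT}) :
    V \subset D -> K <| V -> Npi pi (V / K)%G ->
  Npi pi (f @* V / f @* K)%G.
Proof.
move=> sVD nsKV; pose g := restrm_morphism sVD f.
have gE (A : {group aT}) : A \subset V -> (g @* A)%G = (f @* A)%G.
  by move=> sAV; apply: group_inj; rewrite /= morphim_restrm (setIidPr sAV).
rewrite -(gE V) // -(gE K) ?normal_sub //; apply: Npi_homg; apply/homgP.
by exists (quotm_morphism g nsKV); rewrite morphim_quotm.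
Qed.

(** Lifting subgroups of [G / K] to their preimages turns maximality into an inclusion between
    subsets of [G]. *)
Lemma projectorP (X : group_class) (gT : finGroupType) (G U : {group gT}) :
  projector X G U <-> U \subset G /\ forall K : {group gT}, K <| G ->
    X _ (U / K)%G /\
    forall V : {group gT}, K \subset V -> U \subset V -> V \subset G ->
      X _ (V / K)%G -> V \subset K * U.
Proof.
split=> -[sUG prU]; split=> // K nsKG; have [sKG nKG] := andP nsKG.
  have [_ XU maxU] := prU K nsKG; split=> // V sKV sUV sVG XV.
  have := maxU (V / K)%G (quotientS _ sVG) XV.
  by rewrite properE quotientS //= negbK quotientSK //; apply: subset_trans nKG.
have [XU maxU] := prU K nsKG; split=> //; first exact: quotientS.
move=> Vb /(inv_quotientS nsKG)[V /group_inj-> sKV sVG] XV.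
apply/negP=> /properP[sUV [x Vx /negP[]]]; move: x Vx; apply/subsetP.
rewrite quotientSK ?maxU //; last exact: subset_trans nKG.
by rewrite -(mulSGid sKV) -quotientSK //; apply: subset_trans nKG.
Qed.

Lemma projector_mem (pi : nat_pred) (gT : finGroupType) (G U : {group gT}) :
  projector (Npi pi) G U -> Npi pi U.
Proof.
case=> _ /(_ 1%G (normal1 G))[_ XU _].
by apply: Npi_isog XU; rewrite isog_sym quotient1_isog.
Qed.

Lemma projector_max (pi : nat_pred) (gT : finGroupType) (G U V : {group gT}) :
    projector (Npi pi) G U -> U \subset V -> V \subset G -> Npi pi V ->
  V :=: U.
Proof.
case/projectorP=> _ /(_ 1%G (normal1 G))[_ maxU] sUV sVG XV.
apply/eqP; rewrite eqEsubset sUV andbT -[gval U]mul1g maxU ?sub1G //.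
exact: Npi_isog (quotient1_isog V) XV.
Qed.

(** Testing modulo [K / N] in [G / N] amounts to testing modulo [K] in [G], by the third isomorphism
    theorem. *)
Lemma projector_quotient (pi : nat_pred) (gT : finGroupType)
    (G U N : {group gT}) :
  N <| G -> projector (Npi pi) G U -> projector (Npi pi) (G / N)%G (U / N)%G.
Proof.
move=> nsNG prU; have XU := projector_mem prU; have [sNG nNG] := andP nsNG.
case/projectorP: prU => sUG prU; have nNU := subset_trans sUG nNG.
apply/projectorP; split=> [|Kb nsKb]; first exact: quotientS.
have [K /group_inj defK sNK nsKG] := inv_quotientN nsNG nsKb; subst Kb.
split=> [|Vb].
  have nKU : U / N \subset 'N(K / N)
    by rewrite quotient_norms ?(subset_trans sUG) ?normal_norm.
  exact: Npi_homg (quotient_homg nKU) (Npi_homg (quotient_homg nNU) XU).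
move=> sKV sUV /(inv_quotientS nsNG)[V /group_inj defV sNV sVG] XV; subst Vb.
have nNK := subset_trans (normal_sub nsKG) nNG.
rewrite quotientSK // (mulSGid sNV) in sKV.
rewrite quotientSK // (mulSGid sNV) in sUV.
rewrite -quotientMl // quotientS //.
have [_ maxU] := prU K nsKG; apply: maxU => //; apply: Npi_isog XV.
exact: third_isog sNK (normalS sNV sVG nsNG) (normalS sKV sVG nsKG).
Qed.

Lemma projectorJ (pi : nat_pred) (gT : finGroupType) (G U : {group gT}) x :
  projector (Npi pi) G U -> projector (Npi pi) (G :^ x)%G (U :^ x)%G.
Proof.
move=> prU; have XU := projector_mem prU; case/projectorP: prU => sUG prU.
apply/projectorP; split=> [|K nsKG]; first by rewrite conjSg.
have sUxG : U :^ x \subset G :^ x by rewrite conjSg.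
split=> [|V sKV sUV sVG XV].
  apply: Npi_homg (quotient_homg (subset_trans sUxG (normal_norm nsKG))) _.
  by apply: Npi_isog XU; apply: conj_isog.
pose K1 := (K :^ x^-1)%G; pose V1 := (V :^ x^-1)%G.
have nsK1G : K1 <| G by rewrite -(conjsgK x G) normalJ.
have sV1G : V1 \subset G by rewrite -(conjsgK x G) conjSg.
have sV1KU : V1 \subset K1 * U.
  have [_ maxU] := prU K1 nsK1G; apply: maxU => //; first by rewrite conjSg.
    by rewrite -sub_conjg.
  have conjgmG (A : {group gT}) : A \subset V ->
      (conjgm_morphism V x^-1 @* A)%G = (A :^ x^-1)%G.
    by move=> sAV; apply: group_inj; rewrite /= morphim_conj (setIidPr sAV).
  rewrite /V1 /K1 -!conjgmG //.
  exact: Npi_morphim_quotient (subxx V) (normalS sKV sVG nsKG) XV.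
by rewrite -(conjSg _ _ x^-1) conjsMg conjsgK.
Qed.

Lemma coveringJ (pi : nat_pred) (gT : finGroupType) (G E : {group gT}) x :
  x \in G -> covering (Npi pi) G E -> covering (Npi pi) G (E :^ x)%G.
Proof.
move=> Gx [sEG covE]; split=> [|L sEL sLG]; first by rewrite -(conjGid Gx) conjSg.
rewrite -(group_inj (conjsgKV x L) : ((L :^ x^-1) :^ x)%G = L).
apply: projectorJ; apply: covE; first by rewrite -sub_conjg.
by rewrite sub_conjgV conjGid.
Qed.

Lemma covering_projector (X : group_class) (gT : finGroupType)
    (G E : {group gT}) : covering X G E -> projector X G E.
Proof. by case=> sEG; apply. Qed.

(** * Existence of covering subgroups and conjugacy of projectors *)

Lemma covering_exists (pi : nat_pred) (gT : finGroupType) (G : {group gT}) :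
  admissible_series pi G -> exists E : {group gT}, covering (Npi pi) G E.
Proof.
have [n] := ubnP #|G|; elim: n => // n IHn in gT G * => /ltnSE-leGn serG.
have [G1 | ntG] := eqVneq (G : {set gT}) 1.
  have X1 (rT : finGroupType) : Npi pi (1%G : {group rT}).
    by apply: (Npi_admissible (tau := pi)); [left | apply: pgroup1].
  exists G; split=> // L sGL sLG; apply/projectorP; split=> // K nsK.
  have defL : L :=: G by apply/eqP; rewrite eqEsubset sLG.
  split=> [|V _ _ sVL _]; last first.
    by rewrite (subset_trans sVL) // defL mulG_subr.
  apply: Npi_homg (X1 gT); rewrite /= G1.
  by apply: quotient_homg; apply: sub1G.
have [tau adm ntN] := admissible_series_pcore serG ntG.
pose N := 'O_tau(G)%G; have nsNG : N <| G := pcore_normal _ _.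
have [sNG nNG] := andP nsNG.
have ltGN : #|G / N| < n := leq_trans (ltn_quotient ntN sNG) leGn.
have [Tb covTb] := IHn _ (G / N)%G ltGN (admissible_series_quotient nNG serG).
have [sTbG _] := covTb; have XTb := projector_mem (covering_projector covTb).
have [T /group_inj defT sNT sTG] := inv_quotientS nsNG sTbG; subst Tb.
have [U [sUT XU defNU _ maxU]] :=
  Npi_extension adm (normalS sNT sTG nsNG) (pcore_pgroup _ _) XTb.
exists U; have sUG := subset_trans sUT sTG; split=> // L sUL sLG.
have nNL := subset_trans sLG nNG; have nNT := subset_trans sTG nNG.
have defUN : U / N = T / N by rewrite -(quotientMidl N U) defNU.
(* [T] need not lie in [L], but [T / N = U / N] lies in [L / N]. *)
have prTL : projector (Npi pi) (L / N)%G (T / N)%G.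
  have [_ covT] := covTb; apply: covT; last exact: quotientS.
  by rewrite /= -defUN quotientS.
apply/projectorP; split=> // K nsKL; have [sKL nKL] := andP nsKL.
split=> [|V sKV sUV sVL XV].
  exact: Npi_homg (quotient_homg (subset_trans sUL nKL)) XU.
have nNV := subset_trans sVL nNL; have nsKV := normalS sKV sVL nsKL.
have nNK := subset_trans sKL nNL.
(* The projector property of [T / N] in [L / N] modulo [K / N] puts [V] in [N * K * T], and [N] is
   absorbed by [T]. *)
have sVKT : V \subset K * T.
  have /projectorP[_ /(_ _ (quotient_normal N nsKL))[_ maxT]] := prTL.
  have := maxT (V / N)%G (quotientS _ sKV).
  rewrite /= -defUN; move/(_ (quotientS _ sUV) (quotientS _ sVL)).
  move/(_ (Npi_morphim_quotient (coset_morphism N) nNV nsKV XV)).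
  rewrite defUN -quotientMl // quotientSK // mulgA.
  by rewrite -(normC nNK) -mulgA (mulSGid sNT).
(* Now [V = K * (V :&: T)], so [V :&: T] modulo its intersection with [K] is a copy of [V / K]. As
   it lies between [U] and [T], the last conclusion of [Npi_extension] applies. *)
have sVT_V : (V :&: T)%G \subset V := subsetIl _ _.
have defV : K * (V :&: T) = V.
  by rewrite /= setIC group_modl // setIC; apply/setIidPl.
have sVTU : V :&: T \subset (K :&: (V :&: T)) * U.
  apply: (maxU (V :&: T)%G (K :&: (V :&: T))%G).
  - by rewrite subsetI sUV.
  - exact: subsetIr.
  - by rewrite /= setIC; apply: normalGI nsKV.
  have nKVT : V :&: T \subset 'N(K) := subset_trans sVT_V (normal_norm nsKV).
  apply: Npi_isog XV; rewrite isog_sym.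
  have := second_isog nKVT; rewrite -(quotientMidl K (V :&: T)).
  by rewrite defV.
rewrite -{1}defV (subset_trans (mulgS K sVTU)) //.
by rewrite mulgA mulSg // mul_subG ?subsetIl.
Qed.

Lemma projectors_conjugate (pi : nat_pred) (gT : finGroupType)
    (G U V : {group gT}) :
    admissible_series pi G -> projector (Npi pi) G U ->
    projector (Npi pi) G V ->
  exists2 x, x \in G & V :=: U :^ x.
Proof.
have [n] := ubnP #|G|; elim: n => // n IHn in gT G U V * => /ltnSE-leGn serG.
move=> prU prV; have [[sUG _] [sVG _]] := (prU, prV).
have [G1 | ntG] := eqVneq (G : {set gT}) 1.
  have trivG (P : {group gT}) : P \subset G -> P :=: 1 by rewrite G1 => /trivgP.
  by exists 1; rewrite ?group1 // (trivG U sUG) (trivG V sVG) conjs1g.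
have [tau adm ntN] := admissible_series_pcore serG ntG.
pose N := 'O_tau(G)%G; have nsNG : N <| G := pcore_normal _ _.
have [sNG nNG] := andP nsNG.
have ltGN : #|G / N| < n := leq_trans (ltn_quotient ntN sNG) leGn.
have prUN := projector_quotient nsNG prU.
have prVN := projector_quotient nsNG prV.
have [xb] := IHn _ _ _ _ ltGN (admissible_series_quotient nNG serG) prUN prVN.
(* Lifting the conjugating element makes [U :^ x] and [V] supplements of [N] in the same group
   [T]. *)
case/morphimP=> x Nx Gx -> {xb} /= defVN.
have prUx : projector (Npi pi) G (U :^ x)%G.
  by rewrite -(group_inj (conjGid Gx) : (G :^ x)%G = G); apply: projectorJ.
have [sUxG _] := prUx.
pose T := (N <*> V)%G.
have nNV := subset_trans sVG nNG; have nNUx := subset_trans sUxG nNG.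
have sTG : T \subset G by rewrite join_subG sNG.
have defT_V : N * V = T by rewrite -norm_joinEr.
have defT_Ux : N * U :^ x = T.
  by rewrite -(quotientK nNUx) quotientJ // -defVN quotientK.
have XTN : Npi pi (T / N)%G.
  rewrite (_ : (T / N)%G = (V / N)%G); first exact: projector_mem prVN.
  by apply: group_inj; rewrite /= -defT_V quotientMidl.
have sNT : N \subset T := joing_subl _ _.
have [W [sWT XW _ conjW _]] :=
  Npi_extension adm (normalS sNT sTG nsNG) (pcore_pgroup _ _) XTN.
(* [P] lies in a conjugate of [W], which is again in [Npi pi]; maximality of the projector [P]
   forces equality. *)
have eqW (P : {group gT}) : projector (Npi pi) G P -> N * P = T ->
    exists2 y, y \in G & P :=: W :^ y.
  move=> prP defNP.
  have sPT : P \subset T by rewrite -defNP mulG_subr.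
  have [y Ty sPWy] := conjW P sPT (projector_mem prP) defNP.
  have Gy := subsetP sTG y Ty; exists y => //.
  rewrite -(projector_max (V := (W :^ y)%G) prP) //.
    by rewrite -(conjGid Gy) conjSg (subset_trans sWT).
  exact: Npi_isog (conj_isog _ _) XW.
have [y Gy defUx] := eqW _ prUx defT_Ux.
have [z Gz ->] := eqW _ prV defT_V.
exists (x * y^-1 * z); first by rewrite !groupM ?groupV.
by rewrite !conjsgM -/(gval (U :^ x)%G) defUx conjsgK.
Qed.

Theorem theorem3p4 (pi : nat_pred) (gT : finGroupType) (G : {group gT})
    (solG : pi'_soluble pi G) :
  [/\ exists U : {group gT}, projector (Npi pi) G U,
      forall U : {group gT}, projector (Npi pi) G U <-> covering (Npi pi) G U
    & conjugacy_class_of_subgroups G (projector (Npi pi) G)].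
Proof.
have serG := pi'_soluble_series solG.
have [E covE] := covering_exists serG; have prE := covering_projector covE.
(* Every projector is conjugate to the covering subgroup [E], and conjugation in [G] preserves
   covering subgroups. *)
have prcov U : projector (Npi pi) G U -> covering (Npi pi) G U.
  move=> prU; have [x Gx defU] := projectors_conjugate serG prE prU.
  by rewrite (group_inj defU : U = (E :^ x)%G); apply: coveringJ.
split; first by exists E.
  by move=> U; split; [apply: prcov | apply: covering_projector].
have [sEG _] := covE; exists E => // V; split=> [prV | [x Gx defV]].
  exact: projectors_conjugate prE prV.
rewrite (group_inj defV : V = (E :^ x)%G).
exact/covering_projector/coveringJ.
Qed.
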